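(* For each $k\ge1$ let $d_k>0$, $C_k>0$, and let $Q_k$ be a real polynomial of exact degree $r_k\ge1$ with $$Q_k(x)=a_{0,k}+2\sum_{m=1}^{r_k}a_{m,k}T_m(x),\qquad a_{m,k}\ge0\ (0\le m\le r_k),\quad a_{r_k,k}>0,$$ such that every (complex) zero of $Q_k$ belongs to $[-1,1)$. Set $f_k(z)=C_kQ_k(\cos(d_kz))$ for $z\in\mathbb{C}$. Assume that: (i) $f_k\to F$ locally uniformly on $\mathbb{C}$ and $F(0)>0$; (ii) $F$ has no nonzero real period; (iii) $\operatorname{ord}(F)<2$; (iv) $F$ is not of finite exponential type. Then, as $k\to\infty$, $$d_k\longrightarrow0,\qquad r_kd_k\longrightarrow\infty,\qquad r_kd_k^2\longrightarrow0.$$ Equivalently, $d_k^{-1}=o(r_k)$ and $r_k=o(d_k^{-2})$.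
   Context: $T_m$ denotes the Chebyshev polynomial of the first kind, $T_m(\cos\theta)=\cos(m\theta)$. Locally uniform convergence on $\mathbb{C}$ means uniform convergence on every compact subset of $\mathbb{C}$. A nonzero real period of $F$ is a real number $L\ne0$ with $F(z+L)=F(z)$ for all $z\in\mathbb{C}$. For an entire function $F$, $M_F(R)=\max_{|z|=R}|F(z)|$ and the order is $\operatorname{ord}(F)=\limsup_{R\to\infty}\frac{\log\log M_F(R)}{\log R}$. $F$ has finite exponential type if there are constants $A,B<\infty$ such that $|F(z)|\le Ae^{B|z|}$ for all $z\in\mathbb{C}$. *)

(* Defs.v *)
From HB Require Import structures.
From mathcomp Require Import all_boot all_order all_algebra.
From mathcomp Require Import complex.
From mathcomp Require Import all_classical all_reals all_analysis.
From mathcomp Require Import ring.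

Set Implicit Arguments.
Unset Strict Implicit.
Unset Printing Implicit Defensive.

Import Order.TTheory GRing.Theory Num.Theory.
Import numFieldNormedType.Exports.

Local Open Scope classical_set_scope.
Local Open Scope complex_scope.
Local Open Scope ring_scope.

(* R[i] has no topology of its own in the libraries; the one of the regular
   module R[i]^o is the usual topology, given by the balls `|x - y| < e. *)
HB.instance Definition _ (R : rcfType) := NormedModule.copy R[i] R[i]^o.

(* The modulus as an element of R: in R[i] the norm `|z| is itself an element
   of R[i], namely (cmod z)%:C. *)
Notation cmod := ComplexField.Normc.normc.

Section ComplexCosine.
Variable R : realType.
Implicit Types (x : R) (z : R[i]).

Definition cexp z : R[i] :=
  (expR (complex.Re z))%:C * (cos (complex.Im z) +i* sin (complex.Im z)).

Definition ccos z : R[i] := (cexp ('i%C * z) + cexp (- ('i%C * z))) / 2.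

Lemma ccos_real x : ccos x%:C = (cos x)%:C.
Proof.
rewrite /ccos /cexp.
have -> : 'i%C * x%:C = 0 +i* x :> R[i] by simpc.
rewrite /= oppr0 expR0 cosN sinN !mul1r.
apply: (mulIf (_ : 2 != 0)); first by rewrite pnatr_eq0.
by rewrite divfK ?pnatr_eq0// mulr_natr mulr2n; simpc.
Qed.

End ComplexCosine.

Section Chebyshev.
Variable R : realType.

Fixpoint chebyshevT (m : nat) : {poly R} :=
  match m with
  | 0 => 1
  | 1 => 'X
  | (n.+1 as p).+1 => 2 *: ('X * chebyshevT p) - chebyshevT n
  end.

Lemma chebyshevTSS (m : nat) :
  chebyshevT m.+2 = 2 *: ('X * chebyshevT m.+1) - chebyshevT m.
Proof. by []. Qed.

Lemma chebyshevT_cos (m : nat) (t : R) :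
  (chebyshevT m).[cos t] = cos (m%:R * t).
Proof.
suff [] : (chebyshevT m).[cos t] = cos (m%:R * t) /\
          (chebyshevT m.+1).[cos t] = cos (m.+1%:R * t) by [].
elim: m => [|m [IH1 IH2]]; first by rewrite /= hornerC hornerX mul0r cos0 mul1r.
split=> //.
rewrite chebyshevTSS.
rewrite hornerD hornerN hornerZ hornerM hornerX IH1 IH2.
have -> : m.+2%:R * t = m.+1%:R * t + t by rewrite -natr1 mulrDl mul1r.
have -> : m%:R * t = m.+1%:R * t - t.
  by rewrite -[m.+1%:R]natr1 mulrDl mul1r addrK.
rewrite cosB cosD; move: (m.+1%:R * t) => u; ring.
Qed.

End Chebyshev.

Section EntireFunctions.
Variable R : realType.
Implicit Types F : R[i] -> R[i].

(* M_F(r); for continuous F and r >= 0 the supremum is attained. *)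
Definition max_modulus F (r : R) : R :=
  sup [set cmod (F z) | z in [set z | cmod z = r]].

(* limsup of log log M_F(r) / log r as r tends to infinity. The convention
   ln x = 0 for x <= 0 only matters if M_F(r) <= 1 for arbitrarily large r. *)
Definition entire_order F : \bar R :=
  limf_esup (fun r : R => (ln (ln (max_modulus F r)) / ln r)%:E) (pinfty_nbhs R).

Definition finite_exponential_type F : Prop :=
  exists A B : R, forall z, cmod (F z) <= A * expR (B * cmod z).

Definition locally_uniform_cvg (f : nat -> R[i] -> R[i]) F : Prop :=
  forall K : set R[i], compact K -> {uniform K, f @ \oo --> F}.

Definition real_period F (L : R) : Prop := forall z, F (z + L%:C) = F z.

End EntireFunctions.

(* Main.v *)
(** If the [d_k] do not tend to 0, multiples of the periods [2 * pi / d_k] of the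
    [f_k] accumulate at a nonzero real number, which is a period of [F].

    Since the Chebyshev coefficients are nonnegative,
    [|f_k z| <= f_k 0 * exp (r_k * d_k * |z|)], so if [r_k * d_k] stays bounded
    along a subsequence then [F] has finite exponential type.

    On the imaginary axis, each root [x] of [Q_k] contributes to
    [f_k (i y) / f_k 0] the factor [(c - x) / (1 - x)] with [c = cosh (d_k * y)];
    as [-1 <= x < 1], this is at least [(1 + c) / 2 >= 1 + (d_k * y)^2 / 16].
    Once [d_k * y] is small the product of the [r_k] factors is at least
    [exp (r_k * d_k^2 * y^2 / 32)], so if [r_k * d_k^2] does not tend to 0 then
    [F] has order at least 2. *)
Require Import Defs.
From mathcomp Require Import all_boot all_order all_algebra.
From mathcomp Require Import complex.
From mathcomp Require Import all_classical all_reals all_analysis.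
From mathcomp Require Import ring lra.

Import Order.TTheory GRing.Theory Num.Theory.
Import numFieldNormedType.Exports.

Local Open Scope classical_set_scope.
Local Open Scope complex_scope.
Local Open Scope ring_scope.

(** * Real-valued modulus and uniform convergence on discs *)

Lemma cmodE {R : realType} (z : R[i]) :
  cmod z = Num.sqrt (complex.Re z ^+ 2 + complex.Im z ^+ 2).
Proof. by case: z. Qed.

Lemma norm_cmod {R : realType} (z : R[i]) : `|z| = (cmod z)%:C.
Proof. by []. Qed.

Lemma cmod_ge0 {R : realType} (z : R[i]) : 0 <= cmod z.
Proof. by rewrite cmodE sqrtr_ge0. Qed.

Lemma cmod_real {R : realType} (x : R) : cmod x%:C = `|x|.
Proof. by rewrite cmodE /= expr0n addr0 sqrtr_sqr. Qed.

Lemma cmodB {R : realType} (x y : R[i]) : cmod (x - y) = cmod (y - x).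
Proof. by rewrite -[x - y]opprB normcN. Qed.

Lemma Re_le_cmod {R : realType} (z : R[i]) : `|complex.Re z| <= cmod z.
Proof.
by rewrite cmodE -sqrtr_sqr ler_wsqrtr// lerDl sqr_ge0.
Qed.

Lemma Im_le_cmod {R : realType} (z : R[i]) : `|complex.Im z| <= cmod z.
Proof.
by rewrite cmodE -sqrtr_sqr ler_wsqrtr// lerDr sqr_ge0.
Qed.

Lemma cmod_le_ReIm {R : realType} (z : R[i]) :
  cmod z <= `|complex.Re z| + `|complex.Im z|.
Proof.
rewrite cmodE -(ger0_norm (addr_ge0 (normr_ge0 _) (normr_ge0 _))) -sqrtr_sqr.
rewrite ler_wsqrtr// sqrrD !real_normK ?num_real// addrAC lerDl.
by rewrite mulrn_wge0// mulr_ge0.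
Qed.

Lemma cmod_sum_le {R : realType} (s : seq nat) (g : nat -> R[i]) :
  cmod (\sum_(i <- s) g i) <= \sum_(i <- s) cmod (g i).
Proof.
apply: (big_rec2 (fun x y => cmod x <= y)); first by rewrite Normc.normc0.
by move=> i y x _ h; apply: le_trans (le_normcD _ _) _; rewrite lerD2l.
Qed.

Lemma continuous_Complex {R : realType} :
  continuous (fun p : R * R => (p.1 +i* p.2 : R[i])).
Proof.
move=> p; apply/cvgrPdist_lt => e; rewrite ltcE/= => /andP[/eqP e0 e_gt0].
have e2 : 0 < complex.Re e / 2 by rewrite divr_gt0.
have /cvgrPdist_lt/(_ _ e2) h1 : q.1 @[q --> p] --> p.1 by exact: cvg_fst.
have /cvgrPdist_lt/(_ _ e2) h2 : q.2 @[q --> p] --> p.2 by exact: cvg_snd.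
apply: filterS2 h1 h2 => q h1 h2.
suff h : cmod ((p.1 - q.1) +i* (p.2 - q.2)) < complex.Re e.
  by rewrite norm_cmod ltcE e0 eqxx.
apply: le_lt_trans (cmod_le_ReIm _) _ => /=.
by rewrite (splitr (complex.Re e)) ltrD.
Qed.

(** Squares replace closed discs as test compacts: a square is the continuous image of a product of
    two segments, so its compactness is that of segments. *)
Definition csquare {R : realType} (M : R) : set R[i] :=
  [set z | `|complex.Re z| <= M /\ `|complex.Im z| <= M].

Lemma csquare_compact {R : realType} (M : R) : compact (csquare M).
Proof.
have -> : csquare M =
    [set (p.1 +i* p.2)%C | p in `[- M, M]%classic `*` `[- M, M]%classic].
  apply/seteqP; split=> [[x y] [/= hx hy]|_ [[x y]/= [hx hy] <-]].
    by exists (x, y) => //=; rewrite !in_itv/= -!ler_norml.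
  by split => /=; move: hx hy; rewrite /= !in_itv/= -!ler_norml.
apply: continuous_compact; first exact/continuous_subspaceT/continuous_Complex.
exact: compact_setX (@segment_compact _ _ _) (@segment_compact _ _ _).
Qed.

Lemma cmod_csquare {R : realType} (M : R) (z : R[i]) :
  cmod z <= M -> csquare M z.
Proof.
by move=> zM; split; apply: le_trans zM; [exact: Re_le_cmod|exact: Im_le_cmod].
Qed.

(** Epsilon form of the convergence, the only one used below: the disc of radius [M] lies in the
    compact [csquare M]. *)
Lemma locally_uniform_cmod {R : realType} (f : nat -> R[i] -> R[i]) F (M e : R) :
  locally_uniform_cvg f F -> 0 < e ->
  \forall k \near \oo, forall z, cmod z <= M -> cmod (F z - f k z) < e.
Proof.
move=> fF e_gt0.
pose U := [set h : R[i] -> R[i] | forall z, csquare M z -> cmod (F z - h z) < e].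
have FU : nbhs (F : {uniform` csquare M -> R[i]}) U.
  have [_ +] := @uniform_nbhs _ (csquare M) R[i] F U; apply.
  exists [set xy : R[i] * R[i] | `|xy.1 - xy.2| < e%:C]; split.
    by rewrite -entourage_ballE; exists e%:C => //=; rewrite ltcR.
  by move=> h /= hh z /hh; rewrite norm_cmod ltcR.
have : \forall k \near \oo, U (f k) by exact: fF (csquare_compact M) _ FU.
by apply: filterS => k h z /cmod_csquare; exact: h.
Qed.

(** * Coordinates and the complex exponential *)

Lemma complex_ReD {R : realType} (z w : R[i]) :
  complex.Re (z + w) = complex.Re z + complex.Re w.
Proof. by case: z w => [? ?] [? ?]. Qed.

Lemma complex_ImD {R : realType} (z w : R[i]) :
  complex.Im (z + w) = complex.Im z + complex.Im w.
Proof. by case: z w => [? ?] [? ?]. Qed.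

Lemma complex_ReN {R : realType} (z : R[i]) : complex.Re (- z) = - complex.Re z.
Proof. by case: z. Qed.

Lemma complex_ImN {R : realType} (z : R[i]) : complex.Im (- z) = - complex.Im z.
Proof. by case: z. Qed.

Lemma complex_ReM {R : realType} (z w : R[i]) : complex.Re (z * w) =
  complex.Re z * complex.Re w - complex.Im z * complex.Im w.
Proof. by case: z w => [? ?] [? ?]. Qed.

Lemma complex_ImM {R : realType} (z w : R[i]) : complex.Im (z * w) =
  complex.Re z * complex.Im w + complex.Im z * complex.Re w.
Proof. by case: z w => [? ?] [? ?]. Qed.

Definition ReImE := (@complex_ReD, @complex_ImD, @complex_ReN, @complex_ImN, @complex_ReM, @complex_ImM).

Lemma eq_ReIm {R : realType} (z w : R[i]) :
  complex.Re z = complex.Re w -> complex.Im z = complex.Im w -> z = w.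
Proof. by case: z w => [? ?] [? ?] /= -> ->. Qed.

Lemma cexpD {R : realType} (z w : R[i]) : cexp (z + w) = cexp z * cexp w.
Proof.
by apply: eq_ReIm; rewrite /cexp ?ReImE/= expRD cosD sinD; ring.
Qed.

Lemma cexp0 {R : realType} : cexp 0 = 1 :> R[i].
Proof. by rewrite /cexp /= expR0 cos0 sin0 mul1r. Qed.

Lemma cexpNK {R : realType} (z : R[i]) : cexp z * cexp (- z) = 1.
Proof. by rewrite -cexpD subrr cexp0. Qed.

Lemma cmod_cexp {R : realType} (z : R[i]) : cmod (cexp z) = expR (complex.Re z).
Proof.
rewrite Normc.normcM cmod_real (ger0_norm (expR_ge0 _)) cmodE /=.
by rewrite cos2Dsin2 sqrtr1 mulr1.
Qed.

Lemma cmod_cexp_le {R : realType} (z : R[i]) : cmod (cexp z) <= expR (cmod z).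
Proof.
rewrite cmod_cexp ler_expR; apply: le_trans (Re_le_cmod z); exact: ler_norm.
Qed.

(** * Upper bound for nonnegative Chebyshev sums at complex cosines *)

Lemma cmodX {R : realType} (z : R[i]) n : cmod (z ^+ n) = cmod z ^+ n.
Proof.
elim: n => [|n IHn]; first by rewrite !expr0 Normc.normc1.
by rewrite !exprS Normc.normcM IHn.
Qed.

Lemma cmod_i {R : realType} (z : R[i]) : cmod ('i%C * z) = cmod z.
Proof. by rewrite Normc.normcM cmodE /= expr0n expr1n add0r sqrtr1 mul1r. Qed.

Lemma ccos0 {R : realType} : ccos 0 = 1 :> R[i].
Proof.
have := ccos_real (0 : R); rewrite cos0 => h; exact: h.
Qed.

(** Algebraic form of [T_m(cos w) = cos(m w)], used for complex [w] with [u] and [v] the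
    exponentials of [i w] and [- i w]. Power sums of [u] and [v] obey the Chebyshev recurrence
    because [u * v = 1]. *)
Lemma chebyshevT_joukowski {R : realType} (u v : R[i]) m : u * v = 1 ->
  (map_poly (real_complex R) (chebyshevT R m)).[(u + v) / 2]
  = (u ^+ m + v ^+ m) / 2.
Proof.
move=> uv1.
have n2 : (2 : R[i]) != 0 by rewrite pnatr_eq0.
suff [] : (map_poly (real_complex R) (chebyshevT R m)).[(u + v) / 2]
    = (u ^+ m + v ^+ m) / 2 /\
  (map_poly (real_complex R) (chebyshevT R m.+1)).[(u + v) / 2]
    = (u ^+ m.+1 + v ^+ m.+1) / 2 by [].
elim: m => [|m [IH1 IH2]].
  by rewrite /= rmorph1 map_polyX hornerX hornerC !expr1 !expr0 divff.
split=> //; rewrite chebyshevTSS rmorphB /= map_polyZ rmorphM /= map_polyX.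
rewrite hornerD hornerN hornerZ hornerM hornerX IH1 IH2.
have -> : (real_complex R) 2 = 2 by rewrite rmorphMn /= rmorph1.
have E : u ^+ m.+2 + v ^+ m.+2 =
  (u + v) * (u ^+ m.+1 + v ^+ m.+1) - (u * v) * (u ^+ m + v ^+ m).
  by rewrite !exprS; ring.
by rewrite E uv1; field.
Qed.

Lemma cmod_chebyshevT_ccos {R : realType} (w : R[i]) m :
  cmod ((map_poly (real_complex R) (chebyshevT R m)).[ccos w])
  <= expR (cmod w) ^+ m.
Proof.
rewrite chebyshevT_joukowski ?cexpNK// Normc.normcM Normc.normcV.
have -> : cmod (2 : R[i]) = 2.
  by rewrite -(rmorph_nat (real_complex R)) cmod_real ger0_norm.
rewrite ler_pdivrMr ?ltr0n// mulr2n mulrDr mulr1.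
apply: le_trans (le_normcD _ _) _; rewrite !cmodX.
by apply: lerD; rewrite lerXn2r ?nnegrE ?cmod_ge0 ?expR_ge0//;
  apply: le_trans (cmod_cexp_le _) _; rewrite ?normcN cmod_i.
Qed.

Lemma chebyshevT1 {R : realType} m : (chebyshevT R m).[1] = 1.
Proof. by rewrite -cos0 chebyshevT_cos mulr0 cos0. Qed.

(** As [T_m(1) = 1] and the coefficients are nonnegative, [Q.[1]] is the sum of their moduli (with
    the factor 2), and each [T_m] contributes growth at most [expR (cmod w) ^+ r]. *)
Lemma cmod_chebyshev_sum_ccos {R : realType} (r : nat) (a : nat -> R)
    (Q : {poly R}) (w : R[i]) :
  (forall m, (m <= r)%N -> 0 <= a m) ->
  Q = (a 0%N)%:P + 2 *: \sum_(1 <= m < r.+1) a m *: chebyshevT R m ->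
  cmod ((map_poly (real_complex R) Q).[ccos w]) <= Q.[1] * expR (cmod w) ^+ r.
Proof.
move=> a0 ->; set E := expR (cmod w).
have E1 : 1 <= E by rewrite -expR0 ler_expR cmod_ge0.
rewrite rmorphD /= map_polyC map_polyZ rmorph_sum /= !hornerD !hornerZ !hornerC.
rewrite !horner_sum mulrDl -mulrA mulr_suml.
apply: le_trans (le_normcD _ _) _; apply: lerD.
  by rewrite cmod_real ger0_norm ?a0// ler_peMr ?a0// exprn_ege1.
rewrite Normc.normcM cmod_real ger0_norm// ler_wpM2l//.
apply: le_trans (cmod_sum_le _ _) _.
rewrite !big_nat; apply: ler_sum => m /andP[_ mr].
rewrite map_polyZ hornerZ Normc.normcM cmod_real ger0_norm ?a0//.
rewrite hornerZ chebyshevT1 mulr1 ler_wpM2l ?a0//.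
by apply: le_trans (cmod_chebyshevT_ccos w m) _; rewrite ler_weXn2l.
Qed.

(** * Lower bound on the imaginary axis from the location of the zeros *)

Lemma cmod_prod {R : realType} (s : seq R[i]) (g : R[i] -> R[i]) :
  cmod (\prod_(i <- s) g i) = \prod_(i <- s) cmod (g i).
Proof.
elim: s => [|x s IHs]; first by rewrite !big_nil Normc.normc1.
by rewrite !big_cons Normc.normcM IHs.
Qed.

(* For [x] in [[-1, 1]] and [1 <= c],
   [c - x - (1 - x) * (1 + c) / 2 = (c - 1) * (1 + x) / 2 >= 0]. *)
Lemma cmod_horner_ge {R : realType} (p : {poly R[i]}) (c : R) :
  p != 0 -> 1 <= c ->
  (forall z, root p z -> exists2 x : R, -1 <= x < 1 & z = x%:C) ->
  cmod p.[1] * ((1 + c) / 2) ^+ (size p).-1 <= cmod p.[c%:C].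
Proof.
move=> p0 c1 zp; have [s ps] := closed_field_poly_normal p.
have lc0 : lead_coef p != 0 by rewrite lead_coef_eq0.
have sz : (size p).-1 = size s.
  by rewrite ps size_scale// size_prod_XsubC.
have sP z : z \in s -> exists2 x : R, -1 <= x < 1 & z = x%:C.
  by move=> zs; apply: zp; rewrite ps rootZ// root_prod_XsubC.
rewrite sz ps !hornerZ !Normc.normcM -mulrA ler_wpM2l ?cmod_ge0//.
rewrite !horner_prod !cmod_prod.
elim: s sP {ps sz} => [|z s IHs] sP.
  by rewrite !big_nil mulr1.
have [x /andP[x1 x2] zx] := sP z (mem_head _ _).
rewrite !big_cons /= exprS.
rewrite mulrACA ler_pM//.
- by rewrite mulr_ge0 ?cmod_ge0// divr_ge0//; lra.
- rewrite mulr_ge0// ?exprn_ge0//; last lra.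
  by rewrite prodr_ge0// => i _; rewrite cmod_ge0.
- rewrite !hornerXsubC zx -(rmorph1 (real_complex R)) -!rmorphB !cmod_real !ger0_norm; nra.
- by apply: IHs => y ys; apply: sP; rewrite in_cons ys orbT.
Qed.

Lemma ccos_imag {R : realType} (t : R) :
  ccos ('i%C * t%:C) = ((expR t + expR (- t)) / 2)%:C.
Proof.
rewrite /ccos /cexp !ReImE /= !(mul0r, mulr0, mul1r, addr0, subr0, sub0r, opprK).
rewrite oppr0 cos0 sin0 !mulr1 rmorphM rmorphD fmorphV rmorph_nat /=.
by rewrite add0r addrC.
Qed.

(** With [s = t / 2], [expR t + expR (- t) - 2] is the square of [expR s - expR (- s)], which is at
    least [(1 + s) - 1 = s]. *)
Lemma cosh_ge {R : realType} (t : R) : 0 <= t ->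
  1 + t ^+ 2 / 8 <= (expR t + expR (- t)) / 2.
Proof.
move=> t0; set s := t / 2; have s0 : 0 <= s by rewrite divr_ge0.
have e1 := expR_ge1Dx s; have p := expR_gt0 (- s).
have e12 : expR s * expR (- s) = 1 by rewrite -expRD subrr expR0.
have e2 : expR (- s) <= 1 by rewrite -expR0 ler_expR; lra.
have -> : t = s + s by rewrite /s -splitr.
rewrite opprD !expRD; nra.
Qed.

(** From [expR (- (t / 2)) >= 1 - t / 2] and [(1 + t) * (1 - t / 2) >= 1] on [[0, 1]]. *)
Lemma expR_half_le {R : realType} (t : R) : 0 <= t <= 1 -> expR (t / 2) <= 1 + t.
Proof.
move=> /andP[t0 t1].
have e1 := expR_ge1Dx (- (t / 2)); have p := expR_gt0 (t / 2).
have e12 : expR (t / 2) * expR (- (t / 2)) = 1 by rewrite -expRD subrr expR0.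
nra.
Qed.

(** * Periodicity of the complex cosine and continuity along real lines *)

Lemma ccos_periodic {R : realType} (z : R[i]) n :
  ccos (z + (2 * pi * n%:R)%:C) = ccos z.
Proof.
have cexp_pi (s : R) : cos s = 1 -> sin s = 0 ->
    forall m, cexp ('i%C * (s * m%:R)%:C) = 1.
  move=> cs ss; elim=> [|m IHm]; first by rewrite mulr0 mulr0 cexp0.
  rewrite -natr1 mulrDr mulr1 rmorphD mulrDr cexpD IHm mul1r.
  apply: eq_ReIm; rewrite /cexp !ReImE /= !(mul0r, mul1r, sub0r, subr0, addr0, add0r).
    by rewrite cs oppr0 expR0 mulr1.
  by rewrite ss mulr0.
have c1 : cexp ('i%C * (2 * pi * n%:R)%:C) = 1 :> R[i].
  by apply: cexp_pi; rewrite mulr_natl ?cos2pi ?sin2pi.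
have c2 : cexp (- ('i%C * (2 * pi * n%:R)%:C)) = 1 :> R[i].
  by have := cexpNK ('i%C * (2 * pi * n%:R)%:C : R[i]); rewrite c1 mul1r.
by rewrite /ccos mulrDr opprD !cexpD c1 c2 !mulr1.
Qed.

(** Continuity is stated coordinatewise so that it reduces to the continuity of the real functions
    [expR], [cos] and [sin]. *)
Definition ReIm_continuous {R : realType} (g : R -> R[i]) :=
  continuous (@complex.Re R \o g) /\ continuous (@complex.Im R \o g).

Lemma ReIm_continuous_cst {R : realType} (c : R[i]) :
  ReIm_continuous (fun _ : R => c).
Proof. by split=> x; exact: cvg_cst. Qed.

Lemma ReIm_continuousD {R : realType} (g h : R -> R[i]) :
  ReIm_continuous g -> ReIm_continuous h ->
  ReIm_continuous (fun t => g t + h t).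
Proof.
move=> [g1 g2] [h1 h2]; split=> x.
  have -> : @complex.Re R \o (fun t => g t + h t) =
    (@complex.Re R \o g) \+ (@complex.Re R \o h) by apply/funext => t /=; rewrite complex_ReD.
  by apply: continuousD; [exact: g1|exact: h1].
have -> : @complex.Im R \o (fun t => g t + h t) =
  (@complex.Im R \o g) \+ (@complex.Im R \o h) by apply/funext => t /=; rewrite complex_ImD.
by apply: continuousD; [exact: g2|exact: h2].
Qed.

Lemma ReIm_continuousM {R : realType} (g h : R -> R[i]) :
  ReIm_continuous g -> ReIm_continuous h ->
  ReIm_continuous (fun t => g t * h t).
Proof.
move=> [g1 g2] [h1 h2]; split=> x.
  have -> : @complex.Re R \o (fun t => g t * h t) =
    (@complex.Re R \o g) \* (@complex.Re R \o h) \- (@complex.Im R \o g) \* (@complex.Im R \o h).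
    by apply/funext => t /=; rewrite complex_ReM.
  apply: continuousB; apply: continuousM.
  - exact: g1.
  - exact: h1.
  - exact: g2.
  - exact: h2.
have -> : @complex.Im R \o (fun t => g t * h t) =
  (@complex.Re R \o g) \* (@complex.Im R \o h) \+ (@complex.Im R \o g) \* (@complex.Re R \o h).
  by apply/funext => t /=; rewrite complex_ImM.
apply: continuousD; apply: continuousM.
- exact: g1.
- exact: h2.
- exact: g2.
- exact: h1.
Qed.

Lemma ReIm_continuous_cexp {R : realType} (g : R -> R[i]) :
  ReIm_continuous g -> ReIm_continuous (fun t => cexp (g t)).
Proof.
move=> [g1 g2]; apply: ReIm_continuousM; split=> x /=.
- exact: (continuous_comp (g1 x) (@continuous_expR R _)).
- exact: cvg_cst.
- exact: (continuous_comp (g2 x) (@continuous_cos R _)).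
- exact: (continuous_comp (g2 x) (@continuous_sin R _)).
Qed.

Lemma ReIm_continuous_horner {R : realType} (p : {poly R[i]}) (g : R -> R[i]) :
  ReIm_continuous g -> ReIm_continuous (fun t => p.[g t]).
Proof.
move=> gc; elim/poly_ind: p => [|p c IHp].
  have -> : (fun t => (0 : {poly R[i]}).[g t]) = fun=> 0.
    by apply/funext => t; rewrite horner0.
  exact: ReIm_continuous_cst.
have -> : (fun t => (p * 'X + c%:P).[g t]) = fun t => p.[g t] * g t + c.
  by apply/funext => t; rewrite hornerMXaddC.
apply: ReIm_continuousD; first exact: ReIm_continuousM.
exact: ReIm_continuous_cst.
Qed.

Lemma ReIm_continuous_ccos {R : realType} (g : R -> R[i]) :
  ReIm_continuous g -> ReIm_continuous (fun t => ccos (g t)).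
Proof.
move=> gc; apply: ReIm_continuousM; last exact: ReIm_continuous_cst.
have ig : ReIm_continuous (fun t => 'i%C * g t).
  by apply: ReIm_continuousM => //; exact: ReIm_continuous_cst.
apply: ReIm_continuousD; apply: ReIm_continuous_cexp => //.
have -> : (fun t => - ('i%C * g t)) = fun t => (- 1) * ('i%C * g t).
  by apply/funext => t; rewrite mulN1r.
by apply: ReIm_continuousM => //; exact: ReIm_continuous_cst.
Qed.

Lemma ReIm_continuous_real {R : realType} : ReIm_continuous (real_complex R).
Proof. by split=> x; [exact: cvg_id|exact: cvg_cst]. Qed.

Lemma ReIm_continuous_near {R : realType} (g : R -> R[i]) (s e : R) :
  ReIm_continuous g -> 0 < e -> \forall t \near s, cmod (g s - g t) < e.
Proof.
move=> [g1 g2] e0.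
have e2 : 0 < e / 2 by rewrite divr_gt0.
have /cvgrPdist_lt/(_ _ e2) h1 := g1 s.
have /cvgrPdist_lt/(_ _ e2) h2 := g2 s.
apply: filterS2 h1 h2 => t h1 h2.
apply: le_lt_trans (cmod_le_ReIm _) _.
by rewrite !ReImE (splitr e) ltrD.
Qed.

(** * Passing periods and growth bounds to the limit along subsequences *)

Lemma cmodD_lt {R : realType} (x y : R[i]) (a b : R) :
  cmod x < a -> cmod y < b -> cmod (x + y) < a + b.
Proof. by move=> xa yb; apply: le_lt_trans (le_normcD _ _) _; exact: ltrD. Qed.

Lemma not_near_oo (P : nat -> Prop) :
  ~ (\forall k \near \oo, P k) -> forall N, exists2 k, (N <= k)%N & ~ P k.
Proof.
move=> nP N; apply: contrapT => h; apply: nP; exists N => // k /= Nk.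
by apply: contrapT => nPk; apply: h; exists k.
Qed.

(** The periods lie in the compact segment [[P, 2 * P]], hence cluster at some [L >= P > 0]; local
    uniform convergence makes [L] a period of [F]. *)
Lemma real_period_lim {R : realType} (f : nat -> R[i] -> R[i]) F (P : R) :
  locally_uniform_cvg f F ->
  (forall k z, (1 <= k)%N -> ReIm_continuous (fun t => f k (z + t%:C))) ->
  0 < P ->
  (forall N, exists2 k, (N <= k)%N &
     exists2 L, P <= L <= 2 * P & real_period (f k) L) ->
  exists2 L, L != 0 & real_period F L.
Proof.
move=> fF fc P0 H.
have {H} /choice [phi H] : forall N, exists kL : nat * R,
    [/\ (N <= kL.1)%N, P <= kL.2 <= 2 * P & real_period (f kL.1) kL.2].
  by move=> N; have [k Nk [L PL kL]] := H N; exists (k, L).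
pose l n := (phi n).2.
have lP : nbhs (l @ \oo) `[P, 2 * P]%classic.
  by exists 0%N => // n _ /=; rewrite in_itv /=; have [] := H n.
have [L [/=]] := @segment_compact _ _ _ (l @ \oo) _ lP.
rewrite in_itv /= => /andP[PL LP] clL; exists L; first by rewrite gt_eqF//; lra.
move=> z; apply/eqP; rewrite -subr_eq0; apply/eqP/Normc.eq0_normc.
apply/eqP; rewrite eq_le cmod_ge0 andbT; apply/ler_addgt0Pl => e e0.
rewrite addr0.
have e5 : 0 < e / 5 by rewrite divr_gt0.
have Mz x : 0 <= x <= 2 * P -> cmod (z + x%:C) <= cmod z + 2 * P.
  move=> /andP[x0 xP]; apply: le_trans (le_normcD _ _) _.
  by rewrite lerD2l cmod_real ger0_norm.
have [N _ HN] := locally_uniform_cmod _ _ (cmod z + 2 * P) _ fF e5.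
have N1 : (1 <= N.+1)%N by [].
(* The continuity of the single function [f N.+1] stands in for that of [F]; the successor ensures
   an index at least 1. *)
have HB := ReIm_continuous_near _ L _ (fc _ z N1) e5.
have ln : nbhs (l @ \oo) [set l n | n in [set n | (N <= n)%N]].
  by exists N => // n /= Nn; exists n.
have [_ [[n /= Nn <-] /= Hn]] := clL _ _ ln HB.
have [nk /andP[l1 l2] per] := H n.
rewrite -/(l n) in l1 l2 per.
(* The period [l n] of [f (phi n).1] links the last two differences. The second difference is small
   by continuity, the other four by uniform approximation. *)
have -> : F (z + L%:C) - F z =
  (F (z + L%:C) - f N.+1 (z + L%:C)) + (f N.+1 (z + L%:C) - f N.+1 (z + (l n)%:C))
  + (f N.+1 (z + (l n)%:C) - F (z + (l n)%:C))
  + (F (z + (l n)%:C) - f (phi n).1 (z + (l n)%:C))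
  + (f (phi n).1 z - F z).
  by rewrite per; ring.
have -> : e = e / 5 + e / 5 + e / 5 + e / 5 + e / 5 by field.
apply/ltW; apply: cmodD_lt.
  apply: cmodD_lt; first apply: cmodD_lt; first apply: cmodD_lt => //.
  - by apply: HN; [exact: leqnSn|apply: Mz; lra].
  - by rewrite cmodB; apply: HN; [exact: leqnSn|apply: Mz; lra].
  - by apply: HN; [exact: leq_trans nk|apply: Mz; lra].
by rewrite cmodB; apply: HN; [exact: leq_trans nk|rewrite lerDl; lra].
Qed.

(** The index [k] may depend on [z], but the constants do not: an error below 1 at both [0] and [z]
    gives the factor [cmod (F 0) + 2]. *)
Lemma finite_exponential_type_lim {R : realType} (f : nat -> R[i] -> R[i]) F
    (B : R) : locally_uniform_cvg f F -> 0 <= B ->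
  (forall N, exists2 k, (N <= k)%N &
     forall z, cmod (f k z) <= cmod (f k 0) * expR (B * cmod z)) ->
  finite_exponential_type F.
Proof.
move=> fF B0 H; exists (cmod (F 0) + 2), B => z.
have [N _ HN] := locally_uniform_cmod _ _ (cmod z) _ fF ltr01.
have [k Nk Hk] := H N.
have h0 : cmod (f k 0) <= cmod (F 0) + 1.
  rewrite -[f k 0](subrK (F 0)) addrC; apply: le_trans (le_normcD _ _) _.
  by rewrite lerD2l cmodB ltW// HN// Normc.normc0 cmod_ge0.
have E1 : 1 <= expR (B * cmod z) by rewrite -expR0 ler_expR mulr_ge0 ?cmod_ge0.
rewrite -[F z](subrK (f k z)); apply: le_trans (le_normcD _ _) _.
have h1 := ltW (HN k Nk z (lexx _)); have h2 := Hk z.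
have := ler_wpM2r (expR_ge0 (B * cmod z)) h0.
lra.
Qed.

(** Ensures that the supremum in [max_modulus F] is taken over a bounded set. *)
Lemma locally_uniform_bounded {R : realType} (f : nat -> R[i] -> R[i]) F :
  locally_uniform_cvg f F ->
  (forall k, (1 <= k)%N -> exists2 B, 0 <= B &
    forall z, cmod (f k z) <= cmod (f k 0) * expR (B * cmod z)) ->
  forall r, exists M, forall z, cmod z <= r -> cmod (F z) <= M.
Proof.
move=> fF H r; have [N _ HN] := locally_uniform_cmod _ _ r _ fF ltr01.
have [//|B B0 HB] := H N.+1.
exists (1 + cmod (f N.+1 0) * expR (B * r)) => z zr.
rewrite -[F z](subrK (f N.+1 z)); apply: le_trans (le_normcD _ _) _.
apply: lerD; first by rewrite ltW// HN//=.
by apply: le_trans (HB z) _; rewrite ler_wpM2l ?cmod_ge0// ler_expR ler_wpM2l.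
Qed.

(** For large [x], [ln (max_modulus F x) >= (c / 2) * x ^+ 2], so the quotient defining the order is
    at least [2 + ln (c / 2) / ln x]. An order below 2 would bound this quotient by some [s < 2]
    near infinity. *)
Lemma entire_order_ge2 {R : realType} (F : R[i] -> R[i]) (A c : R) :
  (forall r, exists M, forall z, cmod z <= r -> cmod (F z) <= M) ->
  0 < A -> 0 < c ->
  (forall y, 0 <= y -> A * expR (c * y ^+ 2) <= cmod (F ('i%C * y%:C))) ->
  (2%:E <= entire_order F)%E.
Proof.
move=> Fb A0 c0 HF; rewrite leNgt; apply/negP; rewrite /entire_order limf_esupE.
move=> /ereal_inf_lt [_ [V [K [_ KV]] <-]] supV.
have [s s2 sV] : exists2 s : R, s < 2 & forall x, V x ->
    ln (ln (max_modulus F x)) / ln x <= s.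
  have ub x : V x -> ((ln (ln (max_modulus F x)) / ln x)%:E <=
      ereal_sup [set (ln (ln (max_modulus F x)) / ln x)%:E | x in V])%E.
    by move=> Vx; apply: ereal_sup_ubound; exists x.
  case: ereal_sup supV ub => [s||] //=.
    by rewrite lte_fin => s2 ub; exists s => // x /ub; rewrite lee_fin.
  by move=> _ ub; exists 0 => // x /ub.
have s20 : 0 < 2 - s by rewrite subr_gt0.
(* For [ln x = X], exceeding [l1] gives [(2 - s) * X] above the modulus of [ln (c / 2)]; [x >= l2]
   and [x >= 1] absorb [ln A] into half of [c * x ^+ 2]; the term in [K] puts [x] in [V]. *)
set l1 := `|ln (c / 2)| / (2 - s); set l2 := 2 * `|ln A| / c.
have l10 : 0 <= l1 by rewrite divr_ge0// ltW.
have l20 : 0 <= l2 by rewrite divr_ge0 ?mulr_ge0// ltW.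
pose X := `|K| + 1 + l1 + l2.
have K0 := normr_ge0 K.
have X1 : 1 <= X by rewrite /X; lra.
pose x := expR X.
have xX : 1 + X <= x by exact: expR_ge1Dx.
have xK : K < x by have := ler_norm K; rewrite /X in xX; lra.
have x0 : 0 < x by exact: expR_gt0.
have lnx : ln x = X by rewrite expRK.
have := sV _ (KV _ xK); apply/negP; rewrite -ltNge ltr_pdivlMr lnx; last lra.
have MF : A * expR (c * x ^+ 2) <= max_modulus F x.
  apply: le_trans (HF _ (ltW x0)) _; apply: ub_le_sup.
    have [M HM] := Fb x; exists M => _ [z /= zx <-]; apply: HM.
    by rewrite zx.
  by exists ('i%C * x%:C) => //; rewrite /mkset cmod_i cmod_real ger0_norm// ltW.
have lnMF : ln A + c * x ^+ 2 <= ln (max_modulus F x).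
  rewrite -[c * _]expRK -lnM ?posrE ?expR_gt0//.
  by rewrite ler_ln ?posrE// ?(lt_le_trans _ MF) ?mulr_gt0 ?expR_gt0.
have cx : (c / 2) * x ^+ 2 <= ln (max_modulus F x).
  apply: le_trans lnMF.
  have h1 : `|ln A| <= (c / 2) * x ^+ 2.
    have -> : `|ln A| = c / 2 * l2 by rewrite /l2; field; rewrite gt_eqF.
    rewrite ler_pM2l ?divr_gt0//.
    have : l2 <= x by rewrite /X in xX; lra.
    nra.
  have := ler_normlW (lexx `|- ln A|); rewrite normrN => h2; lra.
have cx0 : 0 < (c / 2) * x ^+ 2 by rewrite mulr_gt0 ?divr_gt0 ?exprn_gt0.
have : ln (c / 2 * x ^+ 2) <= ln (ln (max_modulus F x)).
  by rewrite ler_ln ?posrE// (lt_le_trans cx0).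
rewrite lnM ?posrE ?divr_gt0 ?exprn_gt0// lnXn// lnx.
apply: lt_le_trans; rewrite mulr2n.
have h1 : `|ln (c / 2)| < (2 - s) * X.
  by rewrite -ltr_pdivrMl// mulrC -/l1 /X; lra.
have := ler_normlW (lexx `|- ln (c / 2)|); rewrite normrN => h2; lra.
Qed.
(** With errors below [cmod (F 0) / 4] at [0] and [z], the loss is [(E + 1) / 4] times [cmod (F 0)],
    at most [E / 2] times it since [E >= 1]. *)
Lemma cmod_ge_lim {R : realType} (f : nat -> R[i] -> R[i]) F (z : R[i]) (E : R) :
  locally_uniform_cvg f F -> 0 < cmod (F 0) -> 1 <= E ->
  (forall N, exists2 k, (N <= k)%N & cmod (f k 0) * E <= cmod (f k z)) ->
  cmod (F 0) / 2 * E <= cmod (F z).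
Proof.
move=> fF F0 E1 H.
have e0 : 0 < cmod (F 0) / 4 by rewrite divr_gt0.
have [N _ HN] := locally_uniform_cmod _ _ (cmod z) _ fF e0.
have [k Nk Hk] := H N.
have h0 : cmod (F 0) <= cmod (F 0) / 4 + cmod (f k 0).
  rewrite -{1}[F 0](subrK (f k 0)); apply: le_trans (le_normcD _ _) _.
  by rewrite lerD2r ltW// HN// Normc.normc0 cmod_ge0.
have h1 : cmod (f k z) <= cmod (F 0) / 4 + cmod (F z).
  rewrite -{1}[f k z](subrK (F z)); apply: le_trans (le_normcD _ _) _.
  by rewrite lerD2r cmodB ltW// HN.
nra.
Qed.

(** * Two-sided growth bounds for [f k], and the three limits by contradiction *)

Theorem theorem2p6 (R : realType) (d C : nat -> R) (r : nat -> nat)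
    (a : nat -> nat -> R) (Q : nat -> {poly R})
    (f : nat -> R[i] -> R[i]) (F : R[i] -> R[i])
    (d_gt0 : forall k, (1 <= k)%N -> 0 < d k)
    (C_gt0 : forall k, (1 <= k)%N -> 0 < C k)
    (r_ge1 : forall k, (1 <= k)%N -> (1 <= r k)%N)
    (Q_deg : forall k, (1 <= k)%N -> size (Q k) = (r k).+1)
    (Q_cheb : forall k, (1 <= k)%N ->
      Q k = (a 0%N k)%:P +
            2 *: \sum_(1 <= m < (r k).+1) a m k *: chebyshevT R m)
    (a_ge0 : forall k m, (1 <= k)%N -> (m <= r k)%N -> 0 <= a m k)
    (a_lead_gt0 : forall k, (1 <= k)%N -> 0 < a (r k) k)
    (Q_zeros : forall k (z : R[i]), (1 <= k)%N ->
      root (map_poly (real_complex R) (Q k)) z ->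
      exists2 x : R, -1 <= x < 1 & z = x%:C)
    (fE : forall k (z : R[i]), (1 <= k)%N ->
      f k z = (C k)%:C *
              (map_poly (real_complex R) (Q k)).[ccos ((d k)%:C * z)])
    (f_cvg : locally_uniform_cvg f F)
    (F0_gt0 : 0 < F 0)
    (F_aperiodic : forall L : R, L != 0 -> ~ real_period F L)
    (F_order : (entire_order F < 2%:E)%E)
    (F_type : ~ finite_exponential_type F) :
  [/\ d @ \oo --> (0 : R),
      (r k)%:R * d k @[k --> \oo] --> +oo
    & (r k)%:R * d k ^+ 2 @[k --> \oo] --> (0 : R)] /\
  ((fun k => (d k)^-1 : R)%R =o_\oo (fun k => (r k)%:R : R)%R /\
   (fun k => (r k)%:R : R)%R =o_\oo (fun k => (d k) ^- 2 : R)%R).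
Proof.
have F0 : 0 < cmod (F 0).
  rewrite lt_def cmod_ge0 andbT; apply: contraTneq F0_gt0.
  by move=> /Normc.eq0_normc ->; rewrite ltxx.
have f0 k : (1 <= k)%N -> cmod (f k 0) = C k * (Q k).[1].
  move=> k1; rewrite fE// mulr0 ccos0 -(rmorph1 (real_complex R)) horner_map.
  (* At [w = 0] the Chebyshev upper bound has right-hand side [(Q k).[1]], which therefore dominates
     a modulus. *)
  have Q1 : 0 <= (Q k).[1].
    have := cmod_chebyshev_sum_ccos (r k) (a ^~ k) (Q k) 0
      (fun m => a_ge0 k m k1) (Q_cheb k k1).
    rewrite Normc.normc0 expR0 expr1n mulr1; exact: le_trans (cmod_ge0 _).
  by rewrite Normc.normcM !cmod_real !ger0_norm// ltW// C_gt0.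
have f_le k : (1 <= k)%N -> forall z,
    cmod (f k z) <= cmod (f k 0) * expR ((r k)%:R * d k * cmod z).
  move=> k1 z; rewrite f0// fE// Normc.normcM cmod_real gtr0_norm ?C_gt0//.
  rewrite -[leRHS]mulrA.
  rewrite (ler_wpM2l (ltW (C_gt0 k k1)))//.
  apply: le_trans (cmod_chebyshev_sum_ccos (r k) (a ^~ k) (Q k) _
      (fun m => a_ge0 k m k1) (Q_cheb k k1)) _.
  rewrite -expRM_natl Normc.normcM cmod_real gtr0_norm ?d_gt0//.
  by rewrite mulrA.
have f_ge k y : (1 <= k)%N -> 0 <= y -> (d k * y) ^+ 2 / 16 <= 1 ->
    cmod (f k 0) * expR ((r k)%:R * d k ^+ 2 / 32 * y ^+ 2)
    <= cmod (f k ('i%C * y%:C)).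
  move=> k1 y0 dy1; have dk := d_gt0 k k1.
  have dy0 : 0 <= d k * y by rewrite mulr_ge0// ltW.
  have -> : f k ('i%C * y%:C) = (C k)%:C *
      (map_poly (real_complex R) (Q k)).[ccos ('i%C * (d k * y)%:C)].
    by rewrite fE// mulrCA rmorphM.
  rewrite fE// mulr0 ccos0 ccos_imag !Normc.normcM -mulrA.
  rewrite ler_wpM2l ?cmod_ge0//.
  have ch := cosh_ge _ dy0; set c := _ / 2 in ch *.
  have s0 : 0 <= (d k * y) ^+ 2 by exact: sqr_ge0.
  have c1 : 1 <= c by lra.
  have p0 : map_poly (real_complex R) (Q k) != 0.
    by rewrite map_poly_eq0 -size_poly_eq0 Q_deg.
  apply: le_trans (cmod_horner_ge _ _ p0 c1 (fun z => Q_zeros k z k1)).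
  rewrite ler_wpM2l ?cmod_ge0// size_map_poly Q_deg//=.
  (* With [t = (d k * y) ^+ 2 / 16], each of the [r k] factors satisfies
     [expR (t / 2) <= 1 + t <= (1 + c) / 2]; the assumption [t <= 1] is the range of the first
     inequality. *)
  have -> : (r k)%:R * d k ^+ 2 / 32 * y ^+ 2
      = (r k)%:R * ((d k * y) ^+ 2 / 16 / 2) by field.
  rewrite expRM_natl lerXn2r ?nnegrE ?expR_ge0//; first lra.
  apply: le_trans (expR_half_le _ _) _; last lra.
  by rewrite dy1 andbT divr_ge0.
have d0 e : 0 < e -> \forall k \near \oo, d k < e.
  move=> e0; apply: contrapT => /not_near_oo H.
  have P0 : 0 < 2 * pi / e by rewrite divr_gt0// mulr_gt0// pi_gt0.
  suff [L L0] : exists2 L, L != 0 & real_period F L by exact: F_aperiodic.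
  apply: (real_period_lim f F (2 * pi / e)) => // [k z k1|N].
    have -> : (fun t : R => f k (z + t%:C)) = fun t => (C k)%:C *
        (map_poly (real_complex R) (Q k)).[ccos ((d k)%:C * (z + t%:C))].
      by apply/funext => t; rewrite fE.
    apply: ReIm_continuousM; first exact: ReIm_continuous_cst.
    apply/ReIm_continuous_horner/ReIm_continuous_ccos/ReIm_continuousM.
      exact: ReIm_continuous_cst.
    apply: ReIm_continuousD; first exact: ReIm_continuous_cst.
    exact: ReIm_continuous_real.
  have [k Nk /negP] := H N.+1; rewrite -leNgt => ed.
  have k1 : (1 <= k)%N by exact: leq_trans Nk.
  have dk := d_gt0 k k1.
  exists k; first exact: ltnW.
  (* Since [d k / e >= 1], rounding it up in this way at most doubles it, so [n] times the period
     [2 * pi / d k] falls between [2 * pi / e] and its double. *)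
  pose n := (Num.truncn (d k / e)).+1.
  have de1 : 1 <= d k / e by rewrite ler_pdivlMr// mul1r.
  have /andP[n1 n2] : d k / e <= n%:R <= 2 * (d k / e).
    have /andP[t1 t2] := truncn_itv (le_trans ler01 de1).
    by rewrite ltW//= /n -natr1; lra.
  exists (2 * pi / d k * n%:R).
    have p0 : 0 < 2 * pi / d k by rewrite divr_gt0// mulr_gt0// pi_gt0.
    have -> : 2 * pi / e = 2 * pi / d k * (d k / e) by field; rewrite !gt_eqF.
    by rewrite (mulrCA 2 (2 * pi / d k)) !ler_pM2l// n1.
  move=> z; rewrite !fE//; congr (_ * _.[_]).
  have -> : (d k)%:C * (z + (2 * pi / d k * n%:R)%:C) =
      (d k)%:C * z + (2 * pi * n%:R)%:C.
    rewrite mulrDr; congr (_ + _); rewrite -(rmorphM (real_complex R)).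
    by congr (_%:C); field; rewrite gt_eqF.
  exact: ccos_periodic.
have rd e : 0 < e -> \forall k \near \oo, e < (r k)%:R * d k.
  move=> e0; apply: contrapT => /not_near_oo H; apply: F_type.
  apply: (finite_exponential_type_lim f F e) => //; first exact: ltW.
  move=> N; have [k Nk /negP] := H N.+1; rewrite -leNgt => rde.
  exists k; first exact: ltnW.
  move=> z; apply: le_trans (f_le k _ z) _; first exact: leq_trans Nk.
  by rewrite ler_wpM2l ?cmod_ge0// ler_expR ler_wpM2r ?cmod_ge0.
have rd2 e : 0 < e -> \forall k \near \oo, (r k)%:R * d k ^+ 2 < e.
  move=> e0; apply: contrapT => /not_near_oo H.
  move: F_order; rewrite ltNge => /negP; apply.
  apply: (entire_order_ge2 F (cmod (F 0) / 2) (e / 32)).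
  - apply: (locally_uniform_bounded f) => // k k1.
    exists ((r k)%:R * d k); last exact: f_le.
    by rewrite mulr_ge0// ltW// d_gt0.
  - by rewrite divr_gt0.
  - by rewrite divr_gt0.
  move=> y y0; apply: (cmod_ge_lim f) => //.
    by rewrite -expR0 ler_expR mulr_ge0 ?sqr_ge0// divr_ge0// ltW.
  (* Once [d k < 4 / (1 + y)], [d k * y <= 4], which is the smallness condition of [f_ge]; [1 + y]
     keeps the denominator positive at [y = 0]. *)
  move=> N; have y1 : 0 < 4 / (1 + y) by rewrite divr_gt0//; lra.
  have [N1 _ HN1] := d0 _ y1.
  have [k Nk /negP] := H (N + N1).+1; rewrite -leNgt => erd.
  have k1 : (1 <= k)%N by exact: leq_trans Nk.
  exists k; first by rewrite (leq_trans _ (ltnW Nk))// leq_addr.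
  have dk := d_gt0 k k1.
  have : d k < 4 / (1 + y).
    by apply: HN1; rewrite /= (leq_trans _ (ltnW Nk))// leq_addl.
  rewrite ltr_pdivlMr; last lra.
  move=> dky; have dky0 : 0 <= d k * y by rewrite mulr_ge0// ltW.
  apply: le_trans (f_ge k y k1 y0 _); last by nra.
  rewrite ler_wpM2l ?cmod_ge0// ler_expR ler_wpM2r ?sqr_ge0//.
  by rewrite ler_pM2r.
have near1 : \forall k \near \oo, (1 <= k)%N by exists 1%N.
split; first split.
- apply/cvgrPdist_lt => e e0; apply: filterS2 near1 (d0 e e0) => k k1.
  by rewrite sub0r normrN gtr0_norm ?d_gt0.
- apply/cvgryPgt => A; have A0 : 0 < `|A| + 1 by rewrite ltr_wpDl.
  apply: filterS (rd _ A0) => k; apply: le_lt_trans.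
  by apply: le_trans (ler_norm _) _; rewrite lerDl.
- apply/cvgrPdist_lt => e e0; apply: filterS2 near1 (rd2 e e0) => k k1.
  by rewrite sub0r normrN ger0_norm// mulr_ge0// sqr_ge0.
(* Clearing positive denominators turns the two little-o bounds into [e^-1 <= r k * d k] and
   [r k * d k ^+ 2 <= e]. *)
split; apply/eqoP => e e0.
- have e'0 : 0 < e^-1 by rewrite invr_gt0.
  apply: filterS2 near1 (rd _ e'0) => k k1 rk; have dk := d_gt0 k k1.
  rewrite gtr0_norm ?invr_gt0// ger0_norm// -[leLHS]mul1r ler_pdivrMr//.
  by rewrite -mulrA -ler_pdivrMl// mulr1 ltW.
- apply: filterS2 near1 (rd2 e e0) => k k1 rk; have dk := d_gt0 k k1.
  rewrite ger0_norm// gtr0_norm ?invr_gt0 ?exprn_gt0//.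
  by rewrite ler_pdivlMr ?exprn_gt0// ltW.
Qed.
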